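(* Let $X$ be a compact Hausdorff space. The topological spaces $X$ and $\mathrm{Max}(C(X))$ (with the Zariski topology) are homeomorphic. Specifically, the function $$\zeta: X\to \mathrm{Max}(C(X)),\qquad x\mapsto \ker(e_x),$$ is a homeomorphism, where $e_x:C(X)\to\mathbb{C}$ is the evaluation $e_x(f)=f(x)$. In particular, $\mathrm{Max}(C(X))$ and $\widehat{C(X)}$ are homeomorphic, where $\widehat{C(X)}$ is equipped with the weak$^*$ topology.
   Context: For a compact Hausdorff space $X$, $C(X)$ is the commutative unital $C^*$-algebra of continuous functions $f:X\to\mathbb{C}$ with pointwise operations, norm $\|f\|_\infty=\sup_{x\in X}|f(x)|$ and involution $f^*(x)=\overline{f(x)}$. For a commutative unital $C^*$-algebra $\mathcal{A}$, an ideal is a self-adjoint (closed under $*$) linear subspace $I\subseteq\mathcal{A}$ with $ab\in I$ for all $a\in\mathcal{A}$, $b\in I$. $\mathrm{Max}(\mathcal{A})$ is the set of maximal ideals of $\mathcal{A}$ (maximal with respect to inclusion among proper ideals). The Zariski topology on $\mathrm{Max}(\mathcal{A})$ is the topology whose closed sets are the sets $V(I)=\{\mathfrak{m}\in\mathrm{Max}(\mathcal{A}) : \mathfrak{m}\supseteq I\}$, for $I$ an ideal of $\mathcal{A}$. $\widehat{\mathcal{A}}$ is the set of nonzero $*$-homomorphisms $\phi:\mathcal{A}\to\mathbb{C}$ (linear, multiplicative, $\phi(a^* )=\overline{\phi(a)}$), viewed as a subset of the topological dual of $\mathcal{A}$; the weak$^*$ topology is the topology generated by the evaluations $\phi\mapsto\phi(a)$,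 $a\in\mathcal{A}$. *)

(* Defs.v *)
From HB Require Import structures.
From mathcomp Require Import all_boot all_order all_algebra.
From mathcomp Require Import all_classical all_reals all_analysis.
From mathcomp Require Import complex.

Set Implicit Arguments.
Unset Strict Implicit.
Unset Printing Implicit Defensive.

Import Order.TTheory GRing.Theory Num.Theory.
Import numFieldNormedType.Exports.

Local Open Scope classical_set_scope.
Local Open Scope ring_scope.
Local Open Scope complex_scope.

(* MathComp-Analysis equips R[i]^o, but not R[i] itself, with the topology
   of the modulus. *)
HB.instance Definition _ (R : realType) := NormedModule.copy R[i] R[i]^o.

Definition homeomorphism (S T : topologicalType) (f : S -> T) : Prop :=
  continuous f /\
  exists g : T -> S, [/\ cancel f g, cancel g f & continuous g].

Definition homeomorphic (S T : topologicalType) : Prop :=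
  exists f : S -> T, homeomorphism f.

(* Commutative unital *-algebras over the complex numbers: the part of the
   structure of a commutative unital C*-algebra on which ideals, the Zariski
   topology, *-homomorphisms and the topology of pointwise convergence depend.
   The zero algebra is allowed, as it is C(X) for X empty.  This excludes the
   algebras of the library, whose rings satisfy 1 != 0 and whose hierarchy has
   no join of pzRingType and lmodType; hence a scaling operation of its own. *)
HB.mixin Record isComStarAlgebra (R : realType) A of GRing.ComPzRing A := {
  cscale : R[i] -> A -> A ;
  star : A -> A ;
  cscaleA : forall k l a, cscale k (cscale l a) = cscale (k * l) a ;
  cscale1 : forall a, cscale 1 a = a ;
  cscaleDr : forall k a b, cscale k (a + b) = cscale k a + cscale k b ;
  cscaleDl : forall k l a, cscale (k + l) a = cscale k a + cscale l a ;
  cscaleAl : forall k a b, cscale k (a * b) = cscale k a * b ;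
  starK : forall a, star (star a) = a ;
  starD : forall a b, star (a + b) = star a + star b ;
  starM : forall a b, star (a * b) = star b * star a ;
  starZ : forall k a, star (cscale k a) = cscale k^* (star a)
}.

#[short(type="comStarAlgType")]
HB.structure Definition ComStarAlgebra (R : realType) :=
  {A of isComStarAlgebra R A & GRing.ComPzRing A}.

Section MaximalSpectrum.
Variables (R : realType) (A : comStarAlgType R).

Record ideal (I : set A) : Prop := Ideal {
  ideal0 : I 0 ;
  idealD : forall a b, I a -> I b -> I (a + b) ;
  idealZ : forall (k : R[i]) a, I a -> I (cscale k a) ;
  ideal_star : forall a, I a -> I (star a) ;
  idealM : forall a b, I b -> I (a * b)
}.

Definition maximal_ideal (m : set A) : Prop :=
  [/\ ideal m, m <> setT &
      forall J, ideal J -> J <> setT -> m `<=` J -> J = m].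

Definition Max : Type := {m : set A | maximal_ideal m}.

Definition ideal_of (m : Max) : set A := proj1_sig m.

HB.instance Definition _ := gen_eqMixin Max.
HB.instance Definition _ := gen_choiceMixin Max.

Definition zariski_closed (I : set A) : set Max :=
  [set m | I `<=` ideal_of m].

Definition zariski_open (U : set Max) : Prop :=
  exists2 I : set A, ideal I & U = ~` zariski_closed I.

Lemma zariski_openT : zariski_open setT.
Proof.
exists setT; first by [].
apply/seteqP; split=> // -[m [im mT mmax]] _ /= Tm; refine (mT _).
by apply/seteqP; split.
Qed.

Lemma idealI (I J : set A) : ideal I -> ideal J -> ideal (I `&` J).
Proof.
move=> [I0 ID IZ IS IM] [J0 JD JZ JS JM]; split => //.
- by move=> a b [? ?] [? ?]; split; [exact: ID|exact: JD].
- by move=> k a [? ?]; split; [exact: IZ|exact: JZ].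
- by move=> a [? ?]; split; [exact: IS|exact: JS].
- by move=> a b [? ?]; split; [exact: IM|exact: JM].
Qed.

Lemma ideal_add (I J : set A) : ideal I -> ideal J ->
  ideal [set x | exists i j, [/\ I i, J j & x = i + j]].
Proof.
move=> [I0 ID IZ IS IM] [J0 JD JZ JS JM]; split.
- by exists 0, 0; split => //; rewrite addr0.
- move=> _ _ [i [j [Ii Jj ->]]] [i' [j' [Ii' Jj' ->]]].
  by exists (i + i'), (j + j'); split; [exact: ID|exact: JD|rewrite addrACA].
- move=> k _ [i [j [Ii Jj ->]]].
  by exists (cscale k i), (cscale k j); split; [exact: IZ|exact: JZ|rewrite cscaleDr].
- move=> _ [i [j [Ii Jj ->]]].
  by exists (star i), (star j); split; [exact: IS|exact: JS|exact: starD].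
- move=> a _ [i [j [Ii Jj ->]]].
  by exists (a * i), (a * j); split; [exact: IM|exact: JM|rewrite mulrDr].
Qed.

Lemma zariski_openI : setI_closed zariski_open.
Proof.
move=> _ _ [I iI ->] [J iJ ->]; exists (I `&` J); first exact: idealI.
rewrite -setCU; congr (~` _); apply/seteqP; split=> m /=.
  by case=> h a [Ia Ja]; exact: h.
move=> IJm; apply: contrapT => /not_orP[nI nJ].
case: m IJm nI nJ => m [im mT mmax]; rewrite /zariski_closed /ideal_of /=.
move=> IJm nI nJ; apply: nJ => b Jb.
pose K := [set x | exists i j, [/\ I i, m j & x = i + j]].
have iK : ideal K by exact: ideal_add.
have mK : m `<=` K.
  by move=> a ma; exists 0, a; split; [exact: ideal0|by []|rewrite add0r].
have IK : I `<=` K.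
  by move=> a Ia; exists a, 0; split; [by []|exact: ideal0|rewrite addr0].
have KT : K = setT.
  by apply: contrapT => nK; apply: nI; rewrite -(mmax K iK nK mK).
have : K 1 by rewrite KT.
case=> i [c [Ii mc e]]; rewrite -[b]mulr1 e mulrDr.
apply: (idealD im); last exact: idealM.
by apply: IJm; split; [exact: idealM|rewrite mulrC; exact: idealM].
Qed.

Lemma zariski_open_bigU (T : Type) (f : T -> set Max) :
  (forall i, zariski_open (f i)) -> zariski_open (\bigcup_i f i).
Proof.
move=> fo; pose B := [set I | ideal I /\ exists i, f i = ~` zariski_closed I].
pose K := [set a | forall J, ideal J -> (forall I, B I -> I `<=` J) -> J a].
exists K.
  split.
  - by move=> J iJ _; exact: ideal0.
  - by move=> a b Ka Kb J iJ BJ; apply: (idealD iJ); [exact: Ka|exact: Kb].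
  - by move=> k a Ka J iJ BJ; apply: (idealZ iJ); exact: Ka.
  - by move=> a Ka J iJ BJ; apply: (ideal_star iJ); exact: Ka.
  - by move=> a b Kb J iJ BJ; apply: (idealM iJ); exact: Kb.
apply/seteqP; split=> m /=.
  move=> [i _]; have [I iI fE] := fo i; rewrite fE => nIm Km; apply: nIm.
  move=> a Ia; apply: Km => J iJ BJ; apply: (BJ I) => //.
  by split=> //; exists i.
move=> nKm; apply: contrapT => nf; apply: nKm => a Ka.
apply: Ka; first by case: (proj2_sig m).
move=> I [iI [i fE]] b Ib; apply: contrapT => nmb; apply: nf; exists i => //.
by rewrite fE => Im; apply: nmb; exact: Im.
Qed.

HB.instance Definition _ := isOpenTopological.Build Max
  zariski_openT zariski_openI zariski_open_bigU.

Lemma zariski_closedP (C : set Max) :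
  closed C <-> exists2 I : set A, ideal I & C = zariski_closed I.
Proof.
rewrite -openC; split=> -[I iI e]; exists I => //; last by rewrite e.
exact: setC_inj.
Qed.

(* The nonzero *-homomorphisms from A to the complex numbers. *)
Record is_character (phi : A -> R[i]) : Prop := IsCharacter {
  characterD : forall a b, phi (a + b) = phi a + phi b ;
  characterZ : forall (k : R[i]) a, phi (cscale k a) = k * phi a ;
  characterM : forall a b, phi (a * b) = phi a * phi b ;
  character_star : forall a, phi (star a) = (phi a)^* ;
  character_neq0 : phi <> (fun=> 0)
}.

Definition spectrum : Type := {phi : A -> R[i] | is_character phi}.

Definition character_of (phi : spectrum) : A -> R[i] := proj1_sig phi.

HB.instance Definition _ := gen_eqMixin spectrum.
HB.instance Definition _ := gen_choiceMixin spectrum.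

Definition eval_at (a : A) (phi : spectrum) : R[i] := character_of phi a.

(* The weak* topology: the coarsest one making all evaluations continuous. *)
HB.instance Definition _ := Topological.copy spectrum
  (sup_topology (fun a : A => Topological.on (initial_topology (eval_at a)))).

End MaximalSpectrum.

Section ContinuousFunctions.
Variables (R : realType) (X : topologicalType).

Definition Cfun : Type := continuousType X R[i].

HB.instance Definition _ := Choice.on Cfun.

Definition Cfun_apply (f : Cfun) : X -> R[i] := f.

Definition mkCfun (f : X -> R[i]) (fc : continuous f) : Cfun := mkcts fc.

Lemma CfunP (f g : Cfun) : (forall x, Cfun_apply f x = Cfun_apply g x) -> f = g.
Proof. by move=> fg; apply/continuousEP. Qed.

Lemma Cfun_continuous (f : Cfun) : continuous (Cfun_apply f).
Proof. exact: (@cts_fun _ _ f). Qed.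

Let ap := Cfun_apply.

Lemma conjc_continuous : continuous (fun z : R[i] => z^*).
Proof.
move=> z; apply/(@cvgrPdist_lt R[i] R[i] _ (nbhs z) _) => e e0.
have : \forall w \near z, `|z - w| < e.
  by apply: (@cvgr_dist_lt R[i] R[i] _ (nbhs z) _ id z).
by apply: filterS => w; rewrite -rmorphB /= normcJ.
Qed.

Lemma Cfun_cst_continuous (k : R[i]) : continuous (fun _ : X => k).
Proof. by move=> x; exact: cvg_cst. Qed.

Lemma Cfun_add_continuous (f g : Cfun) : continuous (fun x => ap f x + ap g x).
Proof. by move=> x; apply: cvgD; exact: Cfun_continuous. Qed.

Lemma Cfun_opp_continuous (f : Cfun) : continuous (fun x => - ap f x).
Proof. by move=> x; apply: cvgN; exact: Cfun_continuous. Qed.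

Lemma Cfun_mul_continuous (f g : Cfun) : continuous (fun x => ap f x * ap g x).
Proof. by move=> x; apply: (@cvgM R[i]); exact: Cfun_continuous. Qed.

Lemma Cfun_star_continuous (f : Cfun) : continuous (fun x => (ap f x)^*).
Proof.
move=> x; apply: continuous_comp; first exact: Cfun_continuous.
exact: conjc_continuous.
Qed.

Lemma Cfun_scale_continuous (k : R[i]) (f : Cfun) :
  continuous (fun x => k * ap f x).
Proof.
by move=> x; apply: (@cvgM R[i]); [exact: cvg_cst|exact: Cfun_continuous].
Qed.

Definition Cfun_cst k := mkCfun (@Cfun_cst_continuous k).
Definition Cfun_add f g := mkCfun (@Cfun_add_continuous f g).
Definition Cfun_opp f := mkCfun (@Cfun_opp_continuous f).
Definition Cfun_mul f g := mkCfun (@Cfun_mul_continuous f g).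
Definition Cfun_scale k f := mkCfun (@Cfun_scale_continuous k f).
Definition Cfun_star f := mkCfun (@Cfun_star_continuous f).

Lemma Cfun_addA : associative Cfun_add.
Proof. by move=> f g h; apply: CfunP => x; exact: addrA. Qed.
Lemma Cfun_addC : commutative Cfun_add.
Proof. by move=> f g; apply: CfunP => x; exact: addrC. Qed.
Lemma Cfun_add0 : left_id (Cfun_cst 0) Cfun_add.
Proof. by move=> f; apply: CfunP => x; exact: add0r. Qed.
Lemma Cfun_addN : left_inverse (Cfun_cst 0) Cfun_opp Cfun_add.
Proof. by move=> f; apply: CfunP => x; exact: addNr. Qed.

HB.instance Definition _ := GRing.isZmodule.Build Cfun
  Cfun_addA Cfun_addC Cfun_add0 Cfun_addN.

Lemma Cfun_mulA : associative Cfun_mul.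
Proof. by move=> f g h; apply: CfunP => x; exact: mulrA. Qed.
Lemma Cfun_mulC : commutative Cfun_mul.
Proof. by move=> f g; apply: CfunP => x; exact: mulrC. Qed.
Lemma Cfun_mul1 : left_id (Cfun_cst 1) Cfun_mul.
Proof. by move=> f; apply: CfunP => x; exact: mul1r. Qed.
Lemma Cfun_mulDl : left_distributive Cfun_mul +%R.
Proof. by move=> f g h; apply: CfunP => x; exact: mulrDl. Qed.

HB.instance Definition _ := GRing.Zmodule_isComPzRing.Build Cfun
  Cfun_mulA Cfun_mulC Cfun_mul1 Cfun_mulDl.

Lemma Cfun_scaleA k l f : Cfun_scale k (Cfun_scale l f) = Cfun_scale (k * l) f.
Proof. by apply: CfunP => x; exact: mulrA. Qed.
Lemma Cfun_scale1 f : Cfun_scale 1 f = f.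
Proof. by apply: CfunP => x; exact: mul1r. Qed.
Lemma Cfun_scaleDr k (f g : Cfun) :
  Cfun_scale k (f + g) = Cfun_scale k f + Cfun_scale k g.
Proof. by apply: CfunP => x; exact: mulrDr. Qed.
Lemma Cfun_scaleDl k l f :
  Cfun_scale (k + l) f = Cfun_scale k f + Cfun_scale l f.
Proof. by apply: CfunP => x; exact: mulrDl. Qed.
Lemma Cfun_scaleAl k (f g : Cfun) : Cfun_scale k (f * g) = Cfun_scale k f * g.
Proof. by apply: CfunP => x; exact: mulrA. Qed.
Lemma Cfun_starK f : Cfun_star (Cfun_star f) = f.
Proof. by apply: CfunP => x; exact: conjcK. Qed.
Lemma Cfun_starD (f g : Cfun) : Cfun_star (f + g) = Cfun_star f + Cfun_star g.
Proof. by apply: CfunP => x; exact: rmorphD. Qed.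
Lemma Cfun_starM (f g : Cfun) : Cfun_star (f * g) = Cfun_star g * Cfun_star f.
Proof. by rewrite mulrC; apply: CfunP => x; exact: rmorphM. Qed.
Lemma Cfun_starZ k f : Cfun_star (Cfun_scale k f) = Cfun_scale k^* (Cfun_star f).
Proof. by apply: CfunP => x; exact: rmorphM. Qed.

HB.instance Definition _ := isComStarAlgebra.Build R Cfun
  Cfun_scaleA Cfun_scale1 Cfun_scaleDr Cfun_scaleDl Cfun_scaleAl
  Cfun_starK Cfun_starD Cfun_starM Cfun_starZ.

Definition evaluation (x : X) (f : Cfun) : R[i] := Cfun_apply f x.

Definition ker_evaluation (x : X) : set Cfun := [set f | evaluation x f = 0].

End ContinuousFunctions.

(* Main.v *)
Require Import Defs.
From mathcomp Require Import all_boot all_order all_algebra.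
From mathcomp Require Import all_classical all_reals all_analysis.
From mathcomp Require Import complex.

(** The theorem rests on two facts about a compact Hausdorff space X.

    Weak Nullstellensatz ([proper_ideal_sub_ker], compactness only): a proper
    ideal I of C(X) has a common zero.  A function of I without zeros would be
    invertible, so every zero set Z(f) with f in I is nonempty; the identity
    Z(f) `&` Z(g) = Z(f^* f + g^* g) makes these zero sets a filter base, and
    any cluster point of that filter lies in all of them, since they are
    closed.  Hence the kernels of evaluations, which are maximal because
    C(X) / ker e_x is the field of scalars, are all the maximal ideals; and
    every character is an evaluation, because its kernel is a proper ideal
    contained in some ker e_x and f - phi(f) 1 lies in that kernel.

    Urysohn's lemma ([separating_Cfun]): the cozero sets [f != 0] form a base of
    the topology of X.  Therefore a continuous surjection from X is a
    homeomorphism as soon as every cozero set is the preimage of an open set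
    ([homeomorphism_cozero]).  This criterion applies both to x |-> ker e_x, for
    which the open set is the complement of V(I) with I the ideal of functions
    vanishing wherever f does, and to x |-> e_x, for which it is the set of
    characters phi with phi(f) != 0.  The last assertion composes the two
    homeomorphisms. *)

Set Implicit Arguments.
Unset Strict Implicit.
Unset Printing Implicit Defensive.

Import Order.TTheory GRing.Theory Num.Theory.
Import numFieldNormedType.Exports.

Local Open Scope classical_set_scope.
Local Open Scope ring_scope.
Local Open Scope complex_scope.

(** * Homeomorphisms *)

Lemma homeomorphic_sym (S T : topologicalType) :
  homeomorphic S T -> homeomorphic T S.
Proof. by case=> f [cf [g [fK gK cg]]]; exists g; split=> //; exists f. Qed.

Lemma homeomorphic_trans (S T U : topologicalType) :
  homeomorphic S T -> homeomorphic T U -> homeomorphic S U.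
Proof.
case=> f [cf [f' [fK f'K cf']]] [g [cg [g' [gK g'K cg']]]].
exists (g \o f); split.
  by move=> x; apply: continuous_comp; [exact: cf|exact: cg].
exists (f' \o g'); split; [exact: can_comp|exact: can_comp|].
by move=> x; apply: continuous_comp; [exact: cg'|exact: cf'].
Qed.

(** * Zero sets and separation by continuous functions *)

Section ContinuousFunctionAlgebra.
Variables (R : realType) (X : topologicalType).
Local Notation C := (Cfun R X).

Lemma closed_set1C (z : R[i]) : closed [set z].
Proof.
apply: accessible_closed_set1; apply: hausdorff_accessible.
exact: norm_hausdorff.
Qed.

Lemma closed_zeros (f : C) : closed [set x | Cfun_apply f x = 0].
Proof.
apply: (@preimage_closed _ _ (Cfun_apply f) [set 0]).
  by move=> x _; exact: Cfun_continuous.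
exact: closed_set1C.
Qed.

Lemma real_complex_continuous : continuous (fun r : R => r%:C : R[i]).
Proof.
move=> r; apply/(@cvgrPdist_lt R[i] R[i] _ _ _) => e e0.
(* A positive complex number is a positive real. *)
have [e' e'0 ->] : exists2 e' : R, 0 < e' & e = e'%:C.
  case: e e0 => a b; rewrite ltcE /= => /andP[/eqP -> a0]; by exists a.
near=> s.
rewrite -rmorphB /= normc_def /= expr0n addr0 sqrtr_sqr ltcR.
near: s; exact: cvgr_dist_lt.
Unshelve. all: by end_near. Qed.

Lemma separating_Cfun (F : set X) (x : X) :
  compact [set: X] -> hausdorff_space X -> closed F -> ~ F x ->
  exists f : C, (forall y, F y -> Cfun_apply f y = 0) /\ Cfun_apply f x <> 0.
Proof.
move=> cptX hausX cF nFx.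
have cx : closed [set x].
  exact/accessible_closed_set1/hausdorff_accessible.
have Fx0 : F `&` [set x] = set0.
  by rewrite -subset0 => y [Fy yx]; apply: nFx; rewrite -yx.
have [f [cf f0 f1 _]] :=
  urysohn_ext_itv (compact_normal hausX cptX) cF cx Fx0 (@ltr01 R).
have cfC : continuous (fun y => (f y)%:C : R[i]).
  move=> y; apply: continuous_comp; first exact: cf.
  exact: real_complex_continuous.
exists (mkCfun cfC); split=> [y Fy|].
  have fy : f y = 0 by apply: f0; exists y.
  by rewrite [LHS](congr1 (real_complex R) fy).
have fx : f x = 1 by apply: f1; exists x.
by rewrite [X in X = 0](congr1 (real_complex R) fx); exact/eqP/oner_neq0.
Qed.

(** By Urysohn's lemma the cozero sets [[f != 0]] separate the points of [X] and
    form a base of its topology.  So if each of them comes from an open set of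
    [T], then [phi] separates points as well, and its inverse is continuous. *)
Lemma homeomorphism_cozero (T : topologicalType) (phi : X -> T) :
  compact [set: X] -> hausdorff_space X ->
  continuous phi -> (forall t, exists x, phi x = t) ->
  (forall f : C, exists2 U : set T, open U &
     forall x, U (phi x) <-> Cfun_apply f x <> 0) ->
  homeomorphism phi.
Proof.
move=> cptX hausX cphi surj_phi cozero; split=> //.
have /choice[psi psiK] := surj_phi.
have phi_inj x y : phi x = phi y -> x = y.
  move=> e; apply: contrapT => xy.
  have cy : closed [set y].
    exact/accessible_closed_set1/hausdorff_accessible.
  have [f [f0 fx]] := separating_Cfun cptX hausX cy xy.
  have [U _ UP] := cozero f.
  have /UP := fx; rewrite e => /UP; apply; exact: f0.
exists psi; split=> // [x|]; first exact/phi_inj/psiK.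
apply/continuousP => V oV; rewrite openE => t Vt.
have [||f [f0 ft]] := @separating_Cfun (~` V) (psi t) cptX hausX.
- by rewrite closedC.
- by move=> /(_ Vt).
have [U oU UP] := cozero f.
rewrite /interior nbhsE; exists U.
  by split=> //; rewrite -(psiK t); exact/UP.
move=> s; rewrite -{1}(psiK s) => /UP fs.
by apply: contrapT => nVs; exact/fs/f0.
Qed.

(** * Ideals of C(X) *)

Definition vanishing_ideal (F : set X) : set C :=
  [set f | forall x, F x -> Cfun_apply f x = 0].

Lemma ideal_vanishing (F : set X) : ideal (vanishing_ideal F).
Proof.
split.
- by [].
- by move=> f g f0 g0 x Fx; rewrite [LHS](congr2 +%R (f0 x Fx) (g0 x Fx)) addr0.
- by move=> k f f0 x Fx; rewrite [LHS](congr1 ( *%R k) (f0 x Fx)) mulr0.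
- by move=> f f0 x Fx; rewrite [LHS](congr1 (@conjc R) (f0 x Fx)) rmorph0.
- move=> f g g0 x Fx.
  by rewrite [LHS](congr1 ( *%R (Cfun_apply f x)) (g0 x Fx)) mulr0.
Qed.

Lemma ker_evaluationE (x : X) :
  @ker_evaluation R X x = vanishing_ideal [set x].
Proof. by apply/seteqP; split=> f /= => [fx _ ->|]; last apply. Qed.

Lemma ideal_ker_evaluation (x : X) : ideal (@ker_evaluation R X x).
Proof. by rewrite ker_evaluationE; exact: ideal_vanishing. Qed.

Lemma ideal_eqT (A : comStarAlgType R) (I : set A) :
  ideal I -> I 1 -> I = setT.
Proof.
move=> iI I1; apply/seteqP; split=> // a _.
by rewrite -(mulr1 a); exact: (idealM iI).
Qed.

(** The quotient by [ker e_x] is the field of scalars: if an ideal containing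
    the kernel also contains [f] with [f x != 0], it contains the function
    [1 - f / f x], which vanishes at [x], and hence [1]. *)
Lemma maximal_ker_evaluation (x : X) : maximal_ideal (@ker_evaluation R X x).
Proof.
split; first exact: ideal_ker_evaluation.
  move=> /seteqP[_ /(_ 1 I)]; exact/eqP/oner_neq0.
move=> J iJ JT kerJ; apply/seteqP; split=> // f Jf.
apply: contrapT => /eqP fx0; apply: JT; apply: ideal_eqT => //.
pose g : C := Defs.cscale (Cfun_apply f x)^-1 f.
rewrite -[1](subrK g); apply: (idealD iJ); last exact: idealZ.
apply: kerJ; change (1 - (Cfun_apply f x)^-1 * Cfun_apply f x = 0).
by rewrite mulVf ?subrr.
Qed.

Lemma ideal_zero_free (I : set C) (f : C) :
  ideal I -> I f -> (forall x, Cfun_apply f x <> 0) -> I = setT.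
Proof.
move=> iI If f0; apply: ideal_eqT => //.
have cV : continuous (fun x => (Cfun_apply f x)^-1).
  move=> x; apply: (@cvgV R[i]); first exact/eqP/f0.
  exact: Cfun_continuous.
have -> : 1 = mkCfun cV * f.
  by apply: CfunP => x; rewrite [RHS]mulVf //; exact/eqP/f0.
exact: idealM.
Qed.

(** A sum of squared moduli vanishes only where every term does; this gives
    [Z(f) `&` Z(g)] as the zero set of a single element of any ideal containing
    [f] and [g]. *)
Lemma zeros_sumsq (f g : C) (x : X) :
  Cfun_apply (star f * f + star g * g) x = 0 ->
  Cfun_apply f x = 0 /\ Cfun_apply g x = 0.
Proof.
rewrite [X in X = 0]/(_^* * _ + _^* * _) => /eqP.
rewrite ![(_^*)%C * _]mulrC paddr_eq0 ?mul_conjC_ge0 //.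
by rewrite !mul_conjC_eq0 => /andP[/eqP ? /eqP ?].
Qed.

(** The common zero is a cluster point of the filter generated by the zero sets
    of the elements of [I]. *)
Lemma proper_ideal_sub_ker (I : set C) :
  compact [set: X] -> ideal I -> I <> setT ->
  exists x, I `<=` @ker_evaluation R X x.
Proof.
move=> cptX iI IT.
pose Z (f : C) := [set x | Cfun_apply f x = 0].
have FZ : ProperFilter (filter_from I Z).
  apply: filter_from_proper.
    apply: filter_from_filter; first by exists 0; exact: ideal0.
    move=> f g If Ig; exists (star f * f + star g * g).
      by apply: (idealD iI); exact: idealM.
    by move=> x /zeros_sumsq.
  move=> f If; apply: contrapT => Zf; apply: IT.
  by apply: (ideal_zero_free iI If) => x fx; apply: Zf; exists x.
have [|x [_ clx]] := cptX _ FZ.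
  exact: filterT.
exists x => f If; apply: (@closed_zeros f); rewrite clusterE in clx.
by apply: clx; exists f.
Qed.

(** * The two homeomorphisms *)

Definition zeta (x : X) : Max C := exist _ _ (maximal_ker_evaluation x).

Lemma zeta_continuous : continuous zeta.
Proof.
apply/continuous_closedP => _ /zariski_closedP[I _ ->].
have -> : zeta @^-1` zariski_closed I =
    \bigcap_(f in I) [set x | Cfun_apply f x = 0].
  by apply/seteqP; split=> x h f If; exact: h.
by apply: closed_bigI => f _; exact: closed_zeros.
Qed.

Lemma zeta_surj (m : Max C) : compact [set: X] -> exists x, zeta x = m.
Proof.
case: m => m maxm cptX; have [im mT mmax] := maxm.
have [x mx] := proper_ideal_sub_ker cptX im mT.
have [ik kT _] := maximal_ker_evaluation x.
by exists x; apply: eq_exist; exact: mmax.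
Qed.

(** The ideal of all functions vanishing on [Z(f)] serves in place of the
    principal ideal of [f]: it contains [f] and has the same zeros. *)
Lemma zeta_cozero (f : C) : exists2 U : set (Max C), open U &
  forall x, U (zeta x) <-> Cfun_apply f x <> 0.
Proof.
pose I := vanishing_ideal [set x | Cfun_apply f x = 0].
exists (~` zariski_closed I).
  rewrite openC; apply/zariski_closedP.
  by exists I => //; exact: ideal_vanishing.
move=> x; split=> [nIx fx|fx Ix]; last by apply: fx; apply: Ix => y.
by apply: nIx => g Ig; exact: Ig.
Qed.

Lemma is_character_evaluation (x : X) : is_character (@evaluation R X x).
Proof.
split=> // e; have : evaluation x (1 : C) = 0 by rewrite e.
exact/eqP/oner_neq0.
Qed.

Definition spectrum_eval (x : X) : spectrum C :=
  exist _ _ (is_character_evaluation x).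

Lemma spectrum_eval_continuous : continuous spectrum_eval.
Proof.
move=> x; apply/cvg_sup => f.
apply: (@continuous_comp_initial _ _ _ (eval_at f)).
exact: Cfun_continuous.
Qed.

Lemma eval_at_continuous (A : comStarAlgType R) (a : A) :
  continuous (eval_at a).
Proof.
move=> phi; have /cvg_sup/(_ a) : nbhs phi --> phi by exact: cvg_id.
move=> h V /(@initial_continuous _ _ (eval_at a)) Va; exact: h Va.
Qed.

Lemma spectrum_eval_cozero (f : C) : exists2 U : set (spectrum C), open U &
  forall x, U (spectrum_eval x) <-> Cfun_apply f x <> 0.
Proof.
exists (eval_at f @^-1` ~` [set 0]) => //.
apply: open_comp; first by move=> phi _; exact: eval_at_continuous.
by rewrite openC; exact: closed_set1C.
Qed.

Lemma ideal_character_ker (A : comStarAlgType R) (phi : A -> R[i]) :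
  is_character phi -> ideal [set a | phi a = 0].
Proof.
move=> [D Z M S _]; split=> /=.
- by apply: (addrI (phi 0)); rewrite -D !addr0.
- by move=> a b a0 b0; rewrite D a0 b0 addr0.
- by move=> k a a0; rewrite Z a0 mulr0.
- by move=> a a0; rewrite S a0 rmorph0.
- by move=> a b b0; rewrite M b0 mulr0.
Qed.

Lemma character1 (A : comStarAlgType R) (phi : A -> R[i]) :
  is_character phi -> phi 1 = 1.
Proof.
move=> [D Z M S n0]; have [p0|p1] := eqVneq (phi 1) 0.
  by case: n0; apply/funext => a; rewrite -(mulr1 a) M p0 mulr0.
by apply: (mulfI p1); rewrite -M !mulr1.
Qed.

Lemma spectrum_eval_surj (chi : spectrum C) :
  compact [set: X] -> exists x, spectrum_eval x = chi.
Proof.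
case: chi => phi ch cptX.
have phi1 := character1 ch.
have kT : [set f | phi f = 0] <> setT.
  move=> /seteqP[_ /(_ 1 I)] /=; rewrite phi1; exact/eqP/oner_neq0.
have [x kx] := proper_ideal_sub_ker cptX (ideal_character_ker ch) kT.
exists x; apply: eq_exist; apply/funext => f.
have [D Z _ _ _] := ch.
(* f - phi(f) 1 lies in the kernel of phi, hence vanishes at x. *)
have : ker_evaluation x (f + Defs.cscale (- phi f) 1).
  by apply: kx; rewrite /= D Z phi1 mulr1 subrr.
rewrite /ker_evaluation /= /evaluation [X in X = 0]/(_ + - phi f * 1) mulr1.
by move/subr0_eq.
Qed.

End ContinuousFunctionAlgebra.

Theorem theorem6p1 (R : realType) (X : topologicalType)
    (cptX : compact [set: X]) (hausX : hausdorff_space X) :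
  homeomorphic X (Max (Cfun R X)) /\
  (exists zeta : X -> Max (Cfun R X),
     (forall x : X, ideal_of (zeta x) = ker_evaluation x) /\
     homeomorphism zeta) /\
  homeomorphic (Max (Cfun R X)) (spectrum (Cfun R X)).
Proof.
have homeo_zeta : homeomorphism (@zeta R X).
  apply: (@homeomorphism_cozero R) => //; first exact: zeta_continuous.
    by move=> m; exact: zeta_surj.
  exact: zeta_cozero.
have homeo_eval : homeomorphism (@spectrum_eval R X).
  apply: (@homeomorphism_cozero R) => //; first exact: spectrum_eval_continuous.
    by move=> chi; exact: spectrum_eval_surj.
  exact: spectrum_eval_cozero.
have XMax : homeomorphic X (Max (Cfun R X)) by exists (@zeta R X).
split=> //; split; first by exists (@zeta R X).
apply: homeomorphic_trans (homeomorphic_sym XMax) _.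
by exists (@spectrum_eval R X).
Qed.
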